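(* Let $n\ge 1$ be an integer, let $J\subseteq\mathbb{R}$ be an open interval, and let $f,g:J\to\mathbb{R}$ be functions having at least $n$ derivatives on $J$, with $f'(t)\neq 0$ for all $t\in J$. Let $x=f(t)$ and $y=g(t)$, so that $y$ is given parametrically as a function of $x$. Then for every $t\in J$, the $n$-th derivative of $y$ with respect to $x$ at the point with parameter $t$ is \[ \frac{d^ny}{dx^n}=\sum_{k=0}^{n-1}(-1)^k\left[f'(t)\right]^{-n-k}\,\boldsymbol{P}_{n,k}(t). \]
   Context: Since $f'$ does not vanish on the interval $J$, $f$ is injective, and $y$ as a function of $x$ is $g\circ f^{-1}$ on $f(J)$. The expression $\frac{d^ny}{dx^n}$ at parameter $t$ means $(g\circ f^{-1})^{(n)}(f(t))$; equivalently, it is obtained from $g$ by applying $n$ times the operation ''take $d/dt$ and divide by $f'(t)$''. Definition of $\boldsymbol{P}_{n,k}(t)$: for integers $n\ge1$ and $k\ge 0$, let $\Pi_{n,k}$ be the set of all set partitions $\pi$ of $\{1,2,\dots,k+n\}$ into exactly $k+1$ (nonempty) blocks such that every block not containing $1$ has at least two elements (only the block containing $1$ may be a singleton). For $\pi\in\Pi_{n,k}$ let $B_1(\pi)$ denote the block containing $1$. Then \[ \boldsymbol{P}_{n,k}(t)=\sum_{\pi\in\Pi_{n,k}} g^{(|B_1(\pi)|)}(t)\prod_{B\in\pi,\ B\ne B_1(\pi)} f^{(|B|)}(t), \] where $h^{(m)}$ is the $m$-th derivative of $h$. An empty sum is $0$ and an empty product is $1$. *)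

(* Defs.v *)
From HB Require Import structures.
From mathcomp Require Import all_boot all_order all_algebra.
From mathcomp Require Import all_classical all_reals all_analysis.

Set Implicit Arguments.
Unset Strict Implicit.
Unset Printing Implicit Defensive.

Import Order.TTheory GRing.Theory Num.Theory.
Import numFieldNormedType.Exports.

Local Open Scope ring_scope.
Local Open Scope classical_set_scope.

(* [J] is meant to be open, so that on [J] the total iterated derivative
   [h^`(m)] depends only on the values of [h] on [J]. *)
Definition times_derivable_on (R : realType) (J : set R) (n : nat)
    (h : R -> R) : Prop :=
  forall m : nat, (m < n)%N -> forall t, J t -> derivable h^`(m) t 1.

(* [pinv J f] is the inverse of the restriction of [f] to [J], when that
   restriction is injective; its values outside [f @` J] are irrelevant. *)
Definition param_fun (R : realType) (J : set R) (f g : R -> R) : R -> R :=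
  g \o pinv J f.

(* {1, ..., N}, as a subset of {0, ..., N} *)
Definition ground (N : nat) : {set 'I_N.+1} := [set i : 'I_N.+1 | (0 < i)%N]%SET.

Definition admissible_partitions (n k : nat) : {set {set {set 'I_(k + n).+1}}} :=
  [set p : {set {set 'I_(k + n).+1}} |
    [&& finset.partition p (ground (k + n)), #|p| == k.+1 &
        [forall B in p, (inord 1 \notin B) ==> (2 <= #|B|)%N]]]%SET.

(* [inord 1] is the element 1 as soon as 1 <= k + n. *)
Definition block1 (n k : nat) (p : {set {set 'I_(k + n).+1}}) :
    {set 'I_(k + n).+1} :=
  finset.pblock p (inord 1).

Definition paramP (R : realType) (n k : nat) (f g : R -> R) (t : R) : R :=
  \sum_(p in admissible_partitions n k)
    g^`(#|block1 p|)%classic t *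
    \prod_(B in p | B != block1 p) f^`(#|B|)%classic t.

(* Main.v *)
(* With D = (1/f'(t)) d/dt, the formula follows by induction on n from the
   recurrence P_{n+1,k} = P_{n,k}' + (n+k-1) f'' P_{n,k-1}.  Combinatorially, pick
   an element x other than 1 in a partition counted by P_{n+1,k}.  If x lies in a
   pair {x, j} with j <> 1, deleting this pair leaves a partition counted by
   P_{n,k-1}, and there are n+k-1 choices of j.  Otherwise deleting x leaves a
   partition counted by P_{n,k} with a distinguished block, to which x belonged;
   this is the Leibniz rule, since enlarging a block by x raises by one the order
   of the corresponding derivative. *)
Require Import Defs.
From HB Require Import structures.
From mathcomp Require Import all_boot all_order all_algebra.
From mathcomp Require Import zify.

Set Implicit Arguments.
Unset Strict Implicit.
Unset Printing Implicit Defensive.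

Import Order.TTheory GRing.Theory Num.Theory.

Local Open Scope ring_scope.

(** * Set partitions with a root point, and the effect of deleting another point *)

Section RootedPartitions.
Variables (T : finType) (a : T).
Implicit Types (D X B C : {set T}) (p q : {set {set T}}) (x j : T) (k : nat).

(** Ground set and root are arbitrary so that deleting points stays within the family; [k] counts
    all blocks, one more than the second index of P_{n,k}. *)
Definition rooted_partitions D k : {set {set {set T}}} :=
  [set p : {set {set T}} | [&& partition p D, #|p| == k &
     [forall B in p, (a \notin B) ==> (2 <= #|B|)%N]]].

Lemma rooted_partitionsP D k p :
  reflect [/\ partition p D, #|p| = k &
              forall B, B \in p -> a \notin B -> (2 <= #|B|)%N]
          (p \in rooted_partitions D k).
Proof.
rewrite inE; apply: (iffP and3P) => -[pD /eqP pk pa]; split=> //.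
  by move=> B Bp aB; move/forall_inP: pa => /(_ B Bp)/implyP; apply.
by apply/forall_inP => B Bp; apply/implyP; exact: pa.
Qed.

Lemma rooted_partitions0 D x p : x \in D -> p \notin rooted_partitions D 0.
Proof.
move=> xD; apply/negP => /rooted_partitionsP[pD /eqP].
rewrite cards_eq0 => /eqP p0; move: xD.
by rewrite -(cover_partition pD) p0 /cover big_set0 inE.
Qed.

Lemma rooted_partitions_card_le D k p :
  a \in D -> p \in rooted_partitions D k -> (k.*2 <= #|D|.+1)%N.
Proof.
move=> aD /rooted_partitionsP[pD <- pa].
have [tp cp] := (partition_trivIset pD, cover_partition pD).
have Xp : pblock p a \in p by rewrite pblock_mem ?cp.
have aX : a \in pblock p a by rewrite mem_pblock cp.
rewrite (card_partition pD) (big_setD1 _ Xp) /= (cardsD1 (pblock p a) p) Xp.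
have X_gt0 : (0 < #|pblock p a|)%N by apply/card_gt0P; exists a.
have : (\sum_(A in p :\ pblock p a) 2 <= \sum_(A in p :\ pblock p a) #|A|)%N.
  apply: leq_sum => B /setD1P[BX Bp]; apply: (pa _ Bp).
  by apply: contra BX => aB; rewrite (def_pblock tp Bp aB).
rewrite sum_nat_const; move: X_gt0.
move: (bigop _ _ _) #|_| #|_| => s u v; lia.
Qed.

(** The other [k - 1] blocks hold at least one point each. This bounds the order of the derivatives
    that a partition contributes. *)
Lemma rooted_partitions_block_le D k p B :
  p \in rooted_partitions D k -> B \in p -> (#|B| + k <= #|D|.+1)%N.
Proof.
move=> /rooted_partitionsP[pD <- _] Bp.
rewrite (card_partition pD) (big_setD1 _ Bp) /= (cardsD1 B p) Bp.
have : (\sum_(A in p :\ B) 1 <= \sum_(A in p :\ B) #|A|)%N.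
  apply: leq_sum => C /setD1P[_ Cp].
  by rewrite card_gt0 (partition_neq0 pD).
rewrite sum_nat_const; move: (bigop _ _ _) #|_| #|_| => s u v; lia.
Qed.

Lemma setU1_rooted_partitions D X k q :
  X \subset D -> X != set0 -> (a \notin X -> 2 <= #|X|)%N ->
  q \in rooted_partitions (D :\: X) k ->
  X \notin q /\ X |: q \in rooted_partitions D k.+1.
Proof.
move=> XD X0 Xa /rooted_partitionsP[qD qk qa].
have Xq : X \notin q.
  apply: contra X0 => Xq; have /subsetP sXD := partitionS qD Xq.
  by apply/eqP/setP => x; rewrite inE; apply/negP => xX; move: (sXD _ xX); rewrite inE xX.
split=> //; apply/rooted_partitionsP; split.
- rewrite -(setID D X) (setIidPr XD); apply: partitionU1 => //.
  by rewrite disjoint_sym disjoints_subset; apply/subsetP => x; rewrite !inE => /andP[].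
- by rewrite cardsU1 Xq qk.
- by move=> B; rewrite !inE => /orP[/eqP->|]; [exact: Xa|exact: qa].
Qed.

Lemma setD1_rooted_partitions D X k p :
  p \in rooted_partitions D k.+1 -> X \in p ->
  p :\ X \in rooted_partitions (D :\: X) k.
Proof.
move=> /rooted_partitionsP[pD pk pa] Xp; apply/rooted_partitionsP; split.
- exact: partitionD1.
- by apply/succn_inj; rewrite -pk (cardsD1 X p) Xp.
- by move=> B /setD1P[_ Bp]; exact: pa.
Qed.

Lemma sum_rooted_partitions_block (V : nmodType) D X k (F : {set {set T}} -> V) :
  X \subset D -> X != set0 -> (a \notin X -> 2 <= #|X|)%N ->
  \sum_(p in rooted_partitions D k.+1 | X \in p) F p =
  \sum_(q in rooted_partitions (D :\: X) k) F (X |: q).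
Proof.
move=> XD X0 Xa.
rewrite (reindex_onto (fun q => X |: q) (fun p => p :\ X)) /=; last first.
  by move=> p /andP[_ Xp]; rewrite setD1K.
apply: eq_bigl => q; apply/idP/idP.
  move=> /andP[/andP[Xqp Xq] /eqP<-].
  exact: setD1_rooted_partitions.
move=> qD; have [Xq ->] := setU1_rooted_partitions XD X0 Xa qD.
by rewrite setU11 /= setU1K.
Qed.

(** For [x != a], this is the case where deleting [x] from its block would leave a forbidden
    singleton. *)
Definition paired p x : bool :=
  [exists j, (j \notin [set a; x]) && ([set x; j] \in p)].

Definition enlarge x q B := (x |: B) |: (q :\ B).

(** The second component remembers which block lost [x], so that [enlarge] can recover [p]. *)
Definition shrink x p :=
  ((pblock p x :\ x) |: (p :\ pblock p x), pblock p x :\ x).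

Lemma shrinkP D k x p : x \in D -> x != a ->
  p \in rooted_partitions D k -> ~~ paired p x ->
  [/\ (shrink x p).1 \in rooted_partitions (D :\ x) k,
      (shrink x p).2 \in (shrink x p).1 &
      enlarge x (shrink x p).1 (shrink x p).2 = p].
Proof.
move=> xD xa pDk nb; rewrite /enlarge /shrink /=.
have [pD pk pa] := rooted_partitionsP _ _ _ pDk.
have [tp cp] := (partition_trivIset pD, cover_partition pD).
set X := pblock p x.
have Xp : X \in p by rewrite pblock_mem ?cp.
have xX : x \in X by rewrite mem_pblock cp.
have XE : x |: (X :\ x) = X by rewrite setD1K.
have cX : #|X| = #|X :\ x|.+1 by rewrite (cardsD1 x X) xX.
have k_gt0 : (0 < k)%N by rewrite -pk; apply/card_gt0P; exists X.
have cXa : a \notin X :\ x -> (2 <= #|X :\ x|)%N.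
  rewrite !inE eq_sym xa /= => aX; have := pa _ Xp aX.
  rewrite cX ltnS leq_eqVlt => /orP[|//]; rewrite eq_sym => /cards1P[j jX].
  (* A single leftover point [j] makes [X] the pair [[set x; j]], and [j != a] because [a] is not in
     [X]. *)
  case/negP: nb; apply/existsP; exists j; rewrite -jX XE Xp andbT !inE negb_or.
  have : j \in X :\ x by rewrite jX set11.
  rewrite !inE => /andP[-> jX']; rewrite andbT.
  by apply: contra aX => /eqP<-.
have X0 : X :\ x != set0.
  have [aX|/cXa h] := boolP (a \in X :\ x); first by apply/set0Pn; exists a.
  by rewrite -card_gt0; lia.
have XD : X :\ x \subset D :\ x by rewrite setSD // (partitionS pD).
have := @setU1_rooted_partitions (D :\ x) (X :\ x) k.-1 (p :\ X) XD X0 cXa.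
rewrite prednK //; case.
  have -> : (D :\ x) :\: (X :\ x) = D :\: X.
    by apply/setP => y; rewrite !inE; case: eqVneq => [->|//]; rewrite xX.
  by apply: setD1_rooted_partitions; rewrite ?prednK.
by move=> nX sX; split=> //; rewrite ?setU11// XE setU1K // setD1K.
Qed.

Lemma enlargeP D k x q B : x \in D -> x != a ->
  q \in rooted_partitions (D :\ x) k -> B \in q ->
  [/\ enlarge x q B \in rooted_partitions D k,
      ~~ paired (enlarge x q B) x,
      x |: B \notin q :\ B &
      shrink x (enlarge x q B) = (q, B)].
Proof.
move=> xD xa qDk Bq.
have [qD qk qa] := rooted_partitionsP _ _ _ qDk.
have xq C : C \in q -> x \notin C.
  by move=> /(partitionS qD)/subsetP CD; apply/negP => /CD; rewrite !inE eqxx.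
have k_gt0 : (0 < k)%N by rewrite -qk; apply/card_gt0P; exists B.
have BD : B \subset D :\ x := partitionS qD Bq.
have xBD : x |: B \subset D.
  by rewrite subUset sub1set xD (subset_trans BD) ?subsetDl.
have xB0 : x |: B != set0 by apply/set0Pn; exists x; rewrite setU11.
have cB : (a \notin x |: B -> 2 <= #|x |: B|)%N.
  rewrite !inE negb_or => /andP[_ aB].
  by rewrite cardsU1 xq // (leq_trans (qa _ Bq aB)) ?leq_addl.
have := @setU1_rooted_partitions D (x |: B) k.-1 (q :\ B) xBD xB0 cB.
rewrite prednK //; case.
  have -> : D :\: (x |: B) = (D :\ x) :\: B by rewrite setDDl.
  by apply: setD1_rooted_partitions; rewrite ?prednK.
move=> xBq eD; split=> //.
(* No block of [q] contains [x], so a pair [[set x; j]] could only be [x |: B]; then [B = [set j]]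
   with [j != a], which [q] forbids. *)
- apply/existsP => -[j /andP[]]; rewrite !inE negb_or => /andP[ja jx].
  case/orP=> [/eqP xjE|/andP[_ /xq]]; last by rewrite !inE eqxx.
  have jB : B = [set j].
    by rewrite -(setU1K (xq _ Bq)) -xjE setU1K // inE eq_sym.
  by have := qa _ Bq; rewrite jB cards1 inE eq_sym ja => /(_ isT).
- have [/partition_trivIset te _ _] := rooted_partitionsP _ _ _ eD.
  rewrite /shrink (@def_pblock _ _ (x |: B)) ?setU11 //.
  by rewrite /enlarge !setU1K ?setD1K ?xq.
Qed.

Lemma sum_rooted_partitions_unpaired (V : nmodType) D k x (F : {set {set T}} -> V) :
  x \in D -> x != a ->
  \sum_(p in rooted_partitions D k | ~~ paired p x) F p =
  \sum_(q in rooted_partitions (D :\ x) k) \sum_(B in q) F (enlarge x q B).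
Proof.
move=> xD xa; rewrite pair_big_dep /=.
rewrite (reindex_onto (fun qB => enlarge x qB.1 qB.2) (shrink x)) /=; last first.
  by move=> p /andP[pD np]; have [] := shrinkP xD xa pD np.
apply: eq_bigl => -[q B]; apply/idP/idP => /=.
  case/andP=> /andP[pD np] /eqP hE.
  by have [] := shrinkP xD xa pD np; rewrite hE /= => -> ->.
case/andP=> qD Bq; have [-> -> _ ->] := enlargeP xD xa qD Bq.
by rewrite eqxx.
Qed.

(** As [x] lies in one block only, its partner [j] is unique, and summing over [j] counts each
    paired partition once. *)
Lemma sum_rooted_partitions_paired (V : nmodType) D k x (F : {set {set T}} -> V) :
  x \in D -> x != a ->
  \sum_(p in rooted_partitions D k.+1 | paired p x) F p =
  \sum_(j in D :\ a :\ x)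
    \sum_(q in rooted_partitions (D :\: [set x; j]) k) F ([set x; j] |: q).
Proof.
move=> xD xa.
transitivity (\sum_(j in D :\ a :\ x)
    \sum_(p in rooted_partitions D k.+1 | [set x; j] \in p) F p); last first.
  apply: eq_bigr => j; rewrite !inE => /and3P[jx ja jD].
  apply: sum_rooted_partitions_block.
  - by rewrite subUset !sub1set xD jD.
  - by apply/set0Pn; exists x; rewrite set21.
  - by rewrite cards2 eq_sym jx.
rewrite (exchange_big_dep (fun p => (p \in rooted_partitions D k.+1) && paired p x)) /=;
    last first.
  move=> j p; rewrite !inE => /and3P[jx ja jD] /andP[-> jp]; rewrite /=.
  by apply/existsP; exists j; rewrite !inE negb_or ja jx.
apply: eq_bigr => p /andP[pD /existsP[j /andP[]]].
rewrite in_set2 negb_or => /andP[ja jx] jp.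
rewrite (big_pred1 j) // => i /=.
have [pP _ _] := rooted_partitionsP _ _ _ pD.
rewrite pD /= !in_setD1; apply/idP/eqP => [/andP[/and3P[ix ia iD] ip]|->].
  have tp := partition_trivIset pP.
  have := def_pblock tp ip (set21 _ _); rewrite (def_pblock tp jp (set21 _ _)).
  by move=> /setP/(_ i); rewrite !inE eqxx orbT (negbTE ix) /= => /eqP.
by rewrite ja jx jp !andbT /=; have /subsetP := partitionS pP jp; apply; exact: set22.
Qed.

(** An arbitrary block weight [phi] separates combinatorics from calculus: the first sum will be the
    Leibniz rule, the second the [f''] term. The factor [*+ (0 < k)] removes the second sum at
    [k = 0], where [k.-1] is truncated. *)
Lemma sum_prod_rooted_partitions (R : comNzRingType) D k x (phi : {set T} -> R) :
  x \in D -> x != a ->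
  \sum_(p in rooted_partitions D k) \prod_(B in p) phi B =
    \sum_(q in rooted_partitions (D :\ x) k)
       \sum_(B in q) phi (x |: B) * \prod_(C in q | C != B) phi C +
    \sum_(j in D :\ a :\ x) (phi [set x; j] *
       \sum_(p in rooted_partitions (D :\: [set x; j]) k.-1) \prod_(B in p) phi B)
      *+ (0 < k)%N.
Proof.
move=> xD xa; rewrite (bigID (paired^~ x)) /= addrC; congr (_ + _).
  rewrite sum_rooted_partitions_unpaired //; apply: eq_bigr => q qD.
  apply: eq_bigr => B Bq; have [_ _ xBq _] := enlargeP xD xa qD Bq.
  rewrite /enlarge big_setU1 //=; congr (_ * _).
  by apply: eq_bigl => C; rewrite !inE andbC.
case: k => [|k].
  rewrite big1 => [|p /andP[]]; last by rewrite (negbTE (rooted_partitions0 _ xD)).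
  by rewrite big1 // => j _; rewrite mulr0n.
rewrite sum_rooted_partitions_paired //; apply: eq_bigr => j.
rewrite !inE => /and3P[jx ja jD].
rewrite /= mulr_sumr; apply: eq_bigr => q qD.
have xjD : [set x; j] \subset D by rewrite subUset !sub1set xD jD.
have xj0 : [set x; j] != set0 by apply/set0Pn; exists x; rewrite set21.
have xj2 : (a \notin [set x; j] -> 2 <= #|[set x; j]|)%N.
  by rewrite cards2 eq_sym jx.
by have [xjq _] := setU1_rooted_partitions xjD xj0 xj2 qD; rewrite big_setU1.
Qed.

End RootedPartitions.

From mathcomp Require Import all_classical all_reals all_analysis.

Import Order.TTheory GRing.Theory Num.Theory.
Import numFieldNormedType.Exports.

Local Open Scope classical_set_scope.

(** * Differentiation of finite sums, finite products and negative powers *)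

Section Derivatives.
Variable R : realType.
Implicit Types (t : R) (h u : R -> R).

Lemma is_derive_bigsum (I : Type) (r : seq I) (P : pred I) (h : I -> R -> R)
    (dh : I -> R) t :
  (forall i, P i -> is_derive t 1 (h i) (dh i)) ->
  is_derive t 1 (fun s => \sum_(i <- r | P i) h i s) (\sum_(i <- r | P i) dh i).
Proof.
move=> hd; rewrite -fct_sumE.
by elim/big_ind2 : _ => // [|] *; [exact: is_derive_cst|exact: is_deriveD].
Qed.

(** The omitted factor is singled out by the value of its index, which removes exactly one factor
    when the sequence is [uniq]. *)
Lemma is_derive_bigprod (I : eqType) (r : seq I) (h : I -> R -> R)
    (dh : I -> R) t :
  uniq r -> (forall i, i \in r -> is_derive t 1 (h i) (dh i)) ->
  is_derive t 1 (fun s => \prod_(i <- r) h i s)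
    (\sum_(i <- r) dh i * \prod_(j <- r | j != i) h j t).
Proof.
elim: r => [_ _|i r ih /= /andP[ir ur] hd].
  rewrite big_nil (_ : (fun s => _) = cst 1); first exact: is_derive_cst.
  by apply/funext => s; rewrite big_nil.
have hi := hd _ (mem_head _ _).
have hr := ih ur (fun j jr => hd j (mem_behead (s := i :: r) jr)).
rewrite (_ : (fun s => _) = h i * (fun s => \prod_(j <- r) h j s)); last first.
  by apply/funext => s; rewrite big_cons.
apply: (is_derive_eq (is_deriveM hi hr)).
rewrite !big_cons /= eqxx /= addrC; congr (_ + _).
  rewrite mulrC; congr (_ * _); rewrite big_seq [RHS]big_seq_cond.
  apply: eq_bigl => j; case jr: (j \in r) => //=.
  by apply/esym; apply: contraNneq ir => <-.
rewrite scaler_sumr [LHS]big_seq [RHS]big_seq; apply: eq_bigr => j jr.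
rewrite big_cons (_ : i != j); last by apply: contraNneq ir => ->.
by rewrite -[_ *: _]/(_ * _) mulrCA.
Qed.

Lemma is_derive_exprN u (du : R) t m : u t != 0 -> is_derive t 1 u du ->
  is_derive t 1 (fun s => u s ^- m) (- (m%:R * u t ^- m.+1 * du)).
Proof.
move=> ut0 ud.
have := is_deriveX m (is_deriveV ut0 ud).
rewrite (_ : (fun y => _) ^+ m = (fun s => u s ^- m)); last first.
  by apply/funext => s; rewrite exprfctE exprVn.
move=> /is_derive_eq; apply; rewrite -![_ *: _]/(_ * _).
case: m => [|m]; first by rewrite !mul0r oppr0.
by rewrite /= -!exprVn mulNr mulrN mulrA -(mulrA _ (_ ^+ m)) -exprD addn2.
Qed.

End Derivatives.

(** * Inverting [f] on [J] and differentiating with respect to [x = f t] *)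

Section Inverse.
Variables (R : realType) (J : set R) (f : R -> R).
Hypotheses (J_open : open J) (J_itv : is_interval J).
Hypothesis f_der : forall t, J t -> derivable f t 1.
Hypothesis f'_neq0 : forall t, J t -> f^`() t != 0.

Lemma near_open t (P : R -> Prop) :
  J t -> (forall s, J s -> P s) -> \forall s \near t, P s.
Proof.
by move=> Jt JP; apply: filterS JP _; exact: open_nbhs_nbhs.
Qed.

Lemma derive_neq0_inj : set_inj J f.
Proof.
have lt_neq a b : J a -> J b -> a < b -> f a != f b.
  move=> Ja Jb ab; apply/eqP => fab.
  have Jab c : c \in `[a, b]%R -> J c.
    by rewrite in_itv /= => /andP[ac cb]; apply: (J_itv Ja Jb); rewrite ac cb.
  have [||//|c cab fc0] := @Rolle R f a b ab.
  - by move=> c cab; apply/f_der/Jab; exact: subset_itv_oo_cc.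
  - by apply: derivable_within_continuous => c cab; apply/f_der/Jab.
  - have Jc : J c by apply/Jab; exact: subset_itv_oo_cc.
    by have := f'_neq0 Jc; rewrite derive1E derive_val eqxx.
move=> a b /set_mem Ja /set_mem Jb fab.
by have [/(lt_neq _ _ Ja Jb)|/(lt_neq _ _ Jb Ja)|//] := ltgtP a b;
  rewrite fab eqxx.
Qed.

(** This is the rule d/dx = (1/f') d/dt. Any [y] determined on the image by [y (f s) = h s] is
    allowed, so the rule can be iterated on the derivatives of [param_fun]. *)
Lemma is_derive_param (h y : R -> R) t (dh : R) :
  (forall s, J s -> y (f s) = h s) -> J t -> is_derive t 1 h dh ->
  is_derive (f t) 1 y (dh / f^`()%classic t).
Proof.
move=> yfh Jt hd.
have fK : {near t, cancel f (pinv J f)}.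
  apply: near_open => // s Js; apply: pinvKV; last exact: mem_set.
  exact: derive_neq0_inj.
have fC : {near t, continuous f}.
  apply: near_open => // s Js.
  by apply/differentiable_continuous; rewrite -derivable1_diffP; exact: f_der.
have gC := near_can_continuous fK fC.
have gK := near_continuous_can_sym fC fK.
have gft : pinv J f (f t) = t := nbhs_singleton fK.
have fD : is_derive t 1 f (f^`()%classic t).
  by rewrite derive1E; apply: derivableP; exact: f_der.
have gD := is_derive_inverse fK fC fD (f'_neq0 Jt).
have hgD : is_derive (f t) 1 (h \o pinv J f) (dh / f^`()%classic t).
  by apply: is_derive1_comp; rewrite gft.
apply: near_eq_is_derive hgD.
(* By continuity, [pinv J f] maps a neighbourhood of [f t] into the open set [J]; with [gK] this
   makes [y] equal to [h \o pinv J f] near [f t]. *)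
have gJ : \forall s \near f t, J (pinv J f s).
  by apply: (nbhs_singleton gC); rewrite gft; exact: near_open.
by near=> s; rewrite /= -yfh ?(near gK s)//; near: s.
Unshelve. all: by end_near. Qed.

End Inverse.

Lemma card_ground N : #|ground N| = N.
Proof.
apply/succn_inj; rewrite -[RHS]card_ord -cardsT (cardsD1 ord0) inE.
by congr (_.+1); apply: eq_card => i; rewrite !inE andbT lt0n.
Qed.

(** * The sums P_{n,k} as functions of [t], their recurrence, and the iterated derivative *)

Section RootedSum.
Variables (R : realType) (f g : R -> R).

(** One weight serves the root block and all others, which turns P_{n,k} into a sum of products over
    all blocks, as the weighted recurrence requires. *)
Definition block_fun (T : finType) (a : T) (B : {set T}) : R -> R :=
  (if a \in B then g else f)^`(#|B|).

Definition rooted_sum (T : finType) (a : T) (D : {set T}) (k : nat) (t : R) : R :=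
  \sum_(p in rooted_partitions a D k) \prod_(B in p) block_fun a B t.

Lemma paramPE n k : (0 < k + n)%N ->
  paramP n k f g = rooted_sum (inord 1) (ground (k + n)) k.+1.
Proof.
move=> kn; apply/funext => t; rewrite /paramP /rooted_sum.
apply: eq_bigr => p /rooted_partitionsP[pD _ _].
have [tp cp] := (finset.partition_trivIset pD, finset.cover_partition pD).
have a1 : (inord 1 : 'I_(k + n).+1) \in ground (k + n) by rewrite inE inordK.
have ap : (inord 1 : 'I_(k + n).+1) \in block1 p by rewrite mem_pblock cp.
have Xp : block1 p \in p by rewrite finset.pblock_mem ?cp.
rewrite [RHS](bigD1 (block1 p)) //= {1}/block_fun ap; congr (_ * _).
apply: eq_bigr => B /andP[Bp BX]; rewrite /block_fun ifN //.
by apply: contra BX => aB; rewrite /block1 (finset.def_pblock tp Bp aB).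
Qed.

(* P_{n+1,k}; the index is shifted because the recurrence starts at P_{1,k}. *)
Fixpoint param_rec (n k : nat) : R -> R :=
  match n with
  | 0 => if k == 0 then g^`() else cst 0
  | m.+1 => fun t => (param_rec m k)^`()%classic t +
      if k is j.+1 then (m.+1 + j)%:R * f^`(2)%classic t * param_rec m j t else 0
  end.

(** The recurrence only calls pairs that again satisfy [n < k]. This provides a vanishing boundary
    term when sums over [k] are matched later. *)
Lemma param_rec_eq0 n k : (n < k)%N -> param_rec n k = cst 0.
Proof.
elim: n k => [|n ih] [|k] //=; rewrite ltnS => nk.
apply/funext => t; rewrite (ih _ (leqW nk)) (ih _ nk) derive1_cst /=.
by rewrite mulr0 addr0.
Qed.

Lemma rooted_sum0 (T : finType) (a : T) (D : {set T}) t :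
  a \in D -> rooted_sum a D 0 t = 0.
Proof.
by move=> aD; apply: big1 => p; rewrite (negbTE (rooted_partitions0 _ _ aD)).
Qed.

Lemma rooted_sum_base (T : finType) (a : T) (D : {set T}) k t :
  a \in D -> #|D| = k.+1 -> rooted_sum a D k.+1 t = param_rec 0 k t.
Proof.
case: k => [|k] aD cD /=; last first.
  (* [k.+2] points cannot form [k.+2] blocks of which only the root block may be a singleton. *)
  apply: big1 => p /(rooted_partitions_card_le aD); rewrite cD; lia.
have /eqP/cards1P[b Db] := cD.
move: aD; rewrite Db inE => /eqP ->.
rewrite /rooted_sum (big_pred1 [set [set b]]%SET) => [|p].
  by rewrite big_set1 /block_fun inE eqxx cards1.
apply/idP/eqP => [/rooted_partitionsP[pD /eqP/cards1P[X pX] _]|->].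
  by rewrite pX; move: (finset.cover_partition pD); rewrite pX /finset.cover big_set1 => ->.
apply/rooted_partitionsP; split.
- rewrite /finset.partition finset.trivIset1 /finset.cover big_set1 eqxx /= inE.
  by apply/eqP => /finset.setP/(_ b); rewrite !inE eqxx.
- by rewrite cards1.
- by move=> B; rewrite inE => /eqP ->; rewrite inE eqxx.
Qed.

Variables (J : set R) (N : nat).
Hypothesis J_open : open J.
Hypotheses (f_der : times_derivable_on J N f) (g_der : times_derivable_on J N g).

(** In the Leibniz rule, raising the order of one factor amounts to adding the outside point [x] to
    its block; [x != a] keeps the choice between [f] and [g]. *)
Lemma is_derive_rooted_sum (T : finType) (a x : T) (D : {set T}) k t :
  J t -> x != a -> x \notin D -> (#|D| < k + N)%N ->
  is_derive t 1 (rooted_sum a D k.+1)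
    (\sum_(q in rooted_partitions a D k.+1)
       \sum_(B in q) block_fun a (x |: B)%SET t *
         \prod_(C in q | C != B) block_fun a C t).
Proof.
move=> Jt xa xD cD; apply: is_derive_bigsum => q qD.
rewrite -big_enum; under eq_bigr do rewrite -big_enum_cond.
rewrite (_ : (fun s => _) = (fun s => \prod_(B <- enum q) block_fun a B s)); last first.
  by apply/funext => s; rewrite -big_enum.
apply: is_derive_bigprod => [|B]; first exact: enum_uniq.
rewrite mem_enum => Bq; have Bk := rooted_partitions_block_le qD Bq.
have xB : x \notin B.
  apply: contra xD; have [pD _ _] := rooted_partitionsP _ _ _ _ qD.
  by have /fintype.subsetP := finset.partitionS pD Bq; apply.
(* Among [k.+1] blocks, [B] has at most [#|D| - k] points, fewer than [N], so its factor is still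
   derivable. *)
have BN : (#|B| < N)%N by lia.
rewrite /block_fun cardsU1 xB add1n !inE eq_sym (negbTE xa) orFb derive1nS derive1E.
by apply: derivableP; case: ifP => _; [exact: g_der|exact: f_der].
Qed.

(** Induction on [n], deleting a point [x] other than the root. The ground set is general because
    both [D :\ x] and [D :\: [set x; j]] occur. *)
Lemma rooted_sumE (T : finType) (a : T) (D : {set T}) n k t :
  (n < N)%N -> a \in D -> #|D| = (k + n).+1 -> J t ->
  rooted_sum a D k.+1 t = param_rec n k t.
Proof.
elim: n k D t => [|n ih] k D t nN aD cD Jt.
  by apply: rooted_sum_base => //; rewrite cD addn0.
have [x] : exists x, x \in (D :\ a)%SET.
  by apply/set0Pn; rewrite -card_gt0; move: cD; rewrite (cardsD1 a D) aD; lia.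
rewrite !inE => /andP[xa xD].
have cDx : #|D :\ x|%SET = (k + n).+1 by move: cD; rewrite (cardsD1 x D) xD; lia.
have aDx : a \in (D :\ x)%SET by rewrite !inE eq_sym xa.
rewrite /rooted_sum (sum_prod_rooted_partitions _ _ xD xa) /=; congr (_ + _).
  have := @is_derive_rooted_sum T a x (D :\ x)%SET k t Jt xa.
  rewrite !inE eqxx cDx => /(_ isT) /= [|_ <-]; first by lia.
  rewrite derive1E; apply: near_eq_derive; apply: (near_open J_open Jt) => s Js.
  by apply: ih => //; lia.
case: k cD cDx => [|k] cD cDx.
  (* With a single block in all, deleting a pair leaves no block for the root. *)
  apply: big1 => j; rewrite !inE => /and3P[jx ja jD].
  rewrite mulr1n -[X in _ * X]/(rooted_sum a (D :\: [set x; j])%SET 0 t).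
  by rewrite rooted_sum0 ?mulr0 // !inE eq_sym (negbTE xa) eq_sym (negbTE ja).
rewrite (eq_bigr (fun=> f^`(2)%classic t * param_rec n k t)) => [|j].
  (* The partner [j] ranges over [D] without [a] and [x], and here [D] has [k + n + 3] points. *)
  rewrite sumr_const (_ : #|_| = n.+1 + k)%N; last first.
    by move: cD; rewrite (cardsD1 a D) aD (cardsD1 x (D :\ a)) !inE xa xD; lia.
  by rewrite -[LHS]mulr_natl mulrA.
rewrite !inE => /and3P[jx ja jD].
have ajx : a \notin [set x; j]%SET by rewrite !inE negb_or !(eq_sym a) xa ja.
rewrite mulr1n -[X in _ * X]/(rooted_sum a (D :\: [set x; j])%SET k.+1 t).
rewrite ih //.
- by rewrite /block_fun (negbTE ajx) cards2 eq_sym jx.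
- exact: ltnW.
- by rewrite inE ajx.
- have xjD : ([set x; j] \subset D)%SET by rewrite finset.subUset !finset.sub1set xD jD.
  by rewrite cardsD (finset.setIidPr xjD) cards2 cD eq_sym jx; lia.
Qed.

(** Derivability is not visible in the recursion, which uses total derivatives. Near a point of [J],
    however, [param_rec] agrees with a rooted sum, a polynomial in derivatives of [f] and [g] of
    order at most [n.+1]. *)
Lemma is_derive_param_rec n k t : (n.+1 < N)%N -> J t ->
  is_derive t 1 (param_rec n k) ((param_rec n k)^`()%classic t).
Proof.
move=> nN Jt.
pose a : 'I_(k + n.+1).+1 := inord 1; pose D := ground (k + n.+1).
(* [ground] omits 0, so [ord0] can serve as the added point outside [D]. *)
have a0 : ord0 != a by rewrite -val_eqE /= inordK; lia.
have D0 : ord0 \notin D by rewrite inE.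
have cD : #|D| = (k + n.+1)%N := card_ground _.
have aD : a \in D by rewrite inE inordK; lia.
have sD := is_derive_rooted_sum Jt a0 D0.
rewrite derive1E; apply: derivableP.
apply: (@near_eq_derivable _ _ _ (rooted_sum a D k.+1)).
  apply: (near_open J_open Jt) => s Js.
  by apply: rooted_sumE => //; [exact: ltnW|rewrite cD addnS].
by have [|//] := sD k; rewrite cD; lia.
Qed.

Hypothesis f'_neq0 : forall t, J t -> f^`() t != 0.

(** The claimed formula at order [n.+1], with [param_rec n k] for P_{n+1,k}. *)
Definition param_deriv n t :=
  \sum_(k < n.+1) (-1) ^+ k * (f^`()%classic t) ^- (n.+1 + k) * param_rec n k t.

(** Differentiating the powers of f' produces the coefficient [n.+1 + k] and a factor [f''];
    shifting [k] by one turns this into the second term of the recurrence and absorbs the sign. The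
    factor f' in front will cancel the division in [is_derive_param]. *)
Lemma is_derive_param_deriv n t : (n.+1 < N)%N -> J t ->
  is_derive t 1 (param_deriv n) (f^`()%classic t * param_deriv n.+1 t).
Proof.
move=> nN Jt.
have f't0 := f'_neq0 Jt.
have f'D : is_derive t 1 f^`() (f^`(2)%classic t).
  rewrite derive1nS derive1E; apply: derivableP.
  by apply: (f_der (m := 1)) => //; lia.
pose d k : R := (-1) ^+ k * (f^`()%classic t ^- (n.+1 + k) * (param_rec n k)^`()%classic t -
    (n.+1 + k)%:R * f^`()%classic t ^- (n.+2 + k) * f^`(2)%classic t * param_rec n k t).
have : is_derive t 1 (param_deriv n) (\sum_(k < n.+1) d k).
  apply: is_derive_bigsum => k _.
  have uD := is_derive_exprN (n.+1 + k) f't0 f'D.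
  have := is_deriveZ ((-1) ^+ k) (is_deriveM uD (is_derive_param_rec k nN Jt)).
  set v := (X in is_derive _ _ X _) => vD.
  rewrite (_ : (fun s => _) = v); last by apply/funext => s; rewrite -mulrA.
  apply: (is_derive_eq vD); rewrite /d -![_ *: _]/(_ * _) -addSn; congr (_ * _).
  by rewrite mulrN [in X in _ - X]mulrC.
move=> /is_derive_eq; apply.
rewrite /param_deriv mulr_sumr /=.
have b0 : (param_rec n n.+1)^`()%classic t = 0.
  by rewrite param_rec_eq0 // derive1_cst.
have uVS m : f^`()%classic t * f^`()%classic t ^- m.+1 = f^`()%classic t ^- m.
  by rewrite exprS invfM mulVKf.
under [RHS]eq_bigr => i _ do rewrite addSn mulrA (mulrCA (f^`()%classic t)) uVS mulrDr.
(* The first sum loses its last index, where [param_rec n n.+1] vanishes; the second loses index 0,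
   where the recurrence has no second term, and is shifted. *)
rewrite big_split /= [X in _ = X + _]big_ord_recr /= b0 mulr0 addr0.
rewrite [X in _ + X]big_ord_recl /= mulr0 add0r -big_split /=.
apply: eq_bigr => i _; rewrite /d /bump /= add1n addSnnS mulrBr !mulrA; congr (_ + _).
by rewrite exprS mulN1r !mulNr (mulrAC ((-1) ^+ i)) -(addSnnS n.+1).
Qed.

End RootedSum.

Theorem theorem1 (R : realType) (n : nat) (J : set R) (f g : R -> R)
  (n_ge1 : (1 <= n)%N)
  (J_open : open J) (J_itv : is_interval J)
  (f_der : times_derivable_on J n f) (g_der : times_derivable_on J n g)
  (f'_neq0 : forall t, J t -> f^`() t != 0) :
  set_inj J f /\
  times_derivable_on (f @` J) n (param_fun J f g) /\
  forall t, J t ->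
    (param_fun J f g)^`(n) (f t) =
    \sum_(k < n) (-1) ^+ k * (f^`()%classic t) ^- (n + k) * paramP n k f g t.
Proof.
have f_der1 t : J t -> derivable f t 1 by exact: (f_der 0).
have f_inj := derive_neq0_inj J_itv f_der1 f'_neq0.
have paramD (y h : R -> R) t (dh : R) : (forall s, J s -> y (f s) = h s) -> J t ->
    is_derive t 1 h dh -> is_derive (f t) 1 y (dh / f^`()%classic t).
  exact: is_derive_param.
have param0 s : J s -> param_fun J f g (f s) = g s.
  by move=> Js; rewrite /param_fun /= pinvKV // inE.
(* The formula starts at order 1; order 0 is [g] itself, handled by [param0]. *)
have param1 m : (m < n)%N -> forall t, J t ->
    (param_fun J f g)^`(m.+1) (f t) = param_deriv f g m t.
  elim: m => [|m ih] mn t Jt.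
    have gD := derivableP (g_der _ mn _ Jt).
    have [_ dy] := paramD _ _ _ _ param0 Jt gD.
    rewrite derive1n1 derive1E dy.
    rewrite /param_deriv big_ord1 /= expr0 mul1r addn0 expr1.
    by rewrite (derive1E g) mulrC.
  have [_ dy] := paramD _ _ _ _ (ih (ltnW mn)) Jt
    (is_derive_param_deriv J_open f_der g_der f'_neq0 mn Jt).
  by rewrite derive1nS derive1E dy mulrAC mulfV ?mul1r ?f'_neq0.
split=> //; split.
- move=> [|m] mn _ [t Jt <-].
    by have [] := paramD _ _ _ _ param0 Jt (derivableP (g_der _ mn _ Jt)).
  (* The formula at order [m.+1] has a right-hand side derivable in [t], which gives derivability in
     [x] of that derivative. *)
  by have [] := paramD _ _ _ _ (param1 m (ltnW mn)) Jt
    (is_derive_param_deriv J_open f_der g_der f'_neq0 mn Jt).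
- case: n n_ge1 f_der g_der param1 => [//|n] _ f_der g_der param1 t Jt.
  rewrite param1 //; apply: eq_bigr => k _; rewrite paramPE ?addnS //.
  congr (_ * _); apply/esym; apply: (rooted_sumE J_open f_der g_der) => //.
  + by rewrite inE inordK.
  + by rewrite card_ground.
Qed.
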